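(* On every recurrent rooted network $(G,c,o)$ there exists a potential $h$ tending to infinity, i.e. a potential $h$ such that for every $M>0$ the set $\{v\in V:h(v)\le M\}$ is finite.
   Context: A network $(G,c)$ is an infinite, connected, locally finite graph $G=(V,E)$ with positive edge weights (conductances) $c_{xy}=c_{yx}$, $xy\in E$; put $c_x=\sum_{z\sim x}c_{xz}$. The network random walk is the Markov chain on $V$ with transition probabilities $p(x,y)=c_{xy}/c_x$ for $x\sim y$. The network is recurrent if this walk is recurrent. A rooted network $(G,c,o)$ is a network with a distinguished vertex $o\in V$. The Laplacian of $f:V\to\mathbb{R}$ is $\Delta f(v)=\sum_{x\sim v}c_{vx}(f(x)-f(v))$. A potential on $(G,c,o)$ is a function $h:V\to[0,\infty)$ with $h(o)=0$, $\Delta h(o)=1$ and $\Delta h(v)=0$ for every $v\ne o$. *)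

(* Defs.v *)
From mathcomp Require Import all_boot all_order all_algebra.
From mathcomp Require Import all_classical all_reals all_analysis.

Set Implicit Arguments.
Unset Strict Implicit.
Unset Printing Implicit Defensive.

Import Order.TTheory GRing.Theory Num.Theory.

Local Open Scope classical_set_scope.
Local Open Scope ring_scope.

(** Infinite, connected, locally finite, simple weighted graphs. Values of
    [cond] outside the edge set carry no meaning and are never used. *)
Record network (R : realType) (V : choiceType) := Network {
  adj : rel V;
  cond : V -> V -> R;
  adj_sym : symmetric adj;
  adj_irrefl : irreflexive adj;
  vertices_infinite : infinite_set [set: V];
  adj_connected : forall x y : V, exists s : seq V, path adj x s /\ last x s = y;
  adj_locally_finite : forall x : V, finite_set [set y | adj x y];
  cond_gt0 : forall x y : V, adj x y -> 0 < cond x y;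
  cond_sym : forall x y : V, adj x y -> cond x y = cond y x }.

Section Networks.
Context (R : realType) (V : choiceType) (N : network R V).

Definition neighbours (x : V) : set V := [set y | adj N x y].

Definition vertex_cond (x : V) : R := \sum_(z \in neighbours x) cond N x z.

Definition trans (x y : V) : R :=
  if adj N x y then cond N x y / vertex_cond x else 0.

(** [X] is a Markov chain with transition probabilities [trans] started at
    [v]. Since [V] is countable, measurability of [X n] for the discrete
    sigma-algebra reduces to singletons. The last clause is the Markov property
    P(X_{n+1} = x_{n+1} | X_0 = x_0, ..., X_n = x_n) = trans x_n x_{n+1},
    multiplied out so that null conditioning events need no exception. *)
Definition network_walk (v : V) (d : measure_display) (Omega : measurableType d)
    (P : probability Omega R) (X : nat -> Omega -> V) : Prop :=
  [/\ forall (n : nat) (x : V), measurable (X n @^-1` [set x]),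
      P (X 0%N @^-1` [set v]) = 1%E &
      forall (n : nat) (x : nat -> V),
        P [set w | forall i : nat, (i <= n.+1)%N -> X i w = x i] =
        (P [set w | forall i : nat, (i <= n)%N -> X i w = x i] *
         (trans (x n) (x n.+1))%:E)%E].

(** The law of the walk from [v] is determined by [network_walk], so the return
    probability does not depend on the realization that is chosen. *)
Definition recurrent : Prop :=
  forall v : V,
    exists (d : measure_display) (Omega : measurableType d)
           (P : probability Omega R) (X : nat -> Omega -> V),
      network_walk v P X /\
      P [set w | exists2 n : nat, (0 < n)%N & X n w = v] = 1%E.

Definition laplacian (f : V -> R) (v : V) : R :=
  \sum_(x \in neighbours v) cond N v x * (f x - f v).

Definition potential (o : V) (h : V -> R) : Prop :=
  [/\ forall v : V, 0 <= h v,
      h o = 0,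
      laplacian h o = 1 &
      forall v : V, v <> o -> laplacian h v = 0].

End Networks.

Definition tends_to_infinity (R : realType) (V : choiceType) (h : V -> R) : Prop :=
  forall M : R, 0 < M -> finite_set [set v | h v <= M].

(* Main.v *)
Require Import Defs.
From mathcomp Require Import all_boot all_order all_algebra finmap.
From mathcomp Require Import all_classical all_reals all_analysis.
From mathcomp Require Import ring lra.

(** Let [L > 0] and suppose that no potential is at least [L] off any ball. Then
    minimizing [sum ((L - h)^+)^2] over potentials [h] yields, for every [k], a
    finitely supported probability measure [nu_k] off the ball of radius [k] with
    [nu_k(h) < L] for all potentials [h]. Let [g_k] be the Green potential of
    [nu_k], with Laplacian [delta_o - nu_k]. Along an ultrafilter the [g_k]
    converge to a potential, so one can select [N] indices for which the mutual
    energies [nu_a(g_b)], [a <> b], are less than [L]. Truncating at height [t]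
    does not increase these energies and makes the self-energies at most [t], so
    the average of the [N] truncated functions has energy at most [L + t / N].
    But its energy product with a test function [phi], [phi o = 1], supported
    where nothing was truncated, is still [-1], while by recurrence [phi] can be
    chosen with arbitrarily small energy (the probability of hitting [o] within
    [n] steps): this contradicts Cauchy-Schwarz. Hence for every [L] some
    potential is at least [L] off a finite set, and a convex combination of such
    potentials tends to infinity. To have only finite sums, Green potentials are
    obtained as limits of solutions of the Neumann problem on balls. *)

Set Implicit Arguments.
Unset Strict Implicit.
Unset Printing Implicit Defensive.

Import Order.TTheory GRing.Theory Num.Theory.
Import numFieldNormedType.Exports.

Local Open Scope classical_set_scope.
Local Open Scope fset_scope.
Local Open Scope ring_scope.


(** * Balls, Laplacians of finite subnetworks, and the Dirichlet energy *)

Section Network.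
Context (R : realType) (V : choiceType) (N : network R V) (o : V).

(** Extension by zero off the edges lets every local sum run over an arbitrary finite set of
    vertices. *)
Definition weight (x y : V) : R := if adj N x y then cond N x y else 0.

Definition nbrs (x : V) : {fset V} := fset_set (neighbours N x).

Fixpoint gball (n : nat) : {fset V} :=
  if n is m.+1 then gball m `|` \bigcup_(x <- gball m) nbrs x else [fset o].

(** The Laplacian of the subnetwork induced by [A], that is, with free boundary; it agrees with that
    of the network wherever all neighbours lie in [A]. *)
Definition lap (A : {fset V}) (f : V -> R) (x : V) : R :=
  \sum_(y <- A) weight x y * (f y - f x).

(** Every edge is counted twice. *)
Definition energy (A : {fset V}) (f g : V -> R) : R :=
  \sum_(x <- A) \sum_(y <- A) weight x y * ((f y - f x) * (g y - g x)).

Lemma weightC x y : weight x y = weight y x.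
Proof. by rewrite /weight (adj_sym N); case: ifP => // h; rewrite cond_sym// (adj_sym N). Qed.

Lemma weight_ge0 x y : 0 <= weight x y.
Proof. by rewrite /weight; case: ifP => // h; exact/ltW/cond_gt0. Qed.

Lemma weight_gt0 x y : adj N x y -> 0 < weight x y.
Proof. by move=> h; rewrite /weight h cond_gt0. Qed.

Lemma mem_nbrs x y : (y \in nbrs x) = adj N x y.
Proof.
rewrite in_fset_set; last exact: adj_locally_finite.
by apply/idP/idP; rewrite inE.
Qed.

Lemma weight_notin x y : y \notin nbrs x -> weight x y = 0.
Proof. by rewrite mem_nbrs /weight => /negbTE ->. Qed.

Lemma laplacianE (A : {fset V}) f x : nbrs x `<=` A -> laplacian N f x = lap A f x.
Proof.
move=> sub; rewrite /laplacian /lap fsbig_finite; last exact: adj_locally_finite.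
rewrite -[RHS](big_fset_incl _ sub); last first.
  by move=> y _ /weight_notin ->; rewrite mul0r.
apply: eq_big_seq => y; rewrite -/(nbrs x) mem_nbrs => xy.
by rewrite /weight xy.
Qed.

Lemma ball_o n : o \in gball n.
Proof. by elim: n => [|n IH] /=; rewrite !inE ?eqxx// IH. Qed.

Lemma ball_step n x y : x \in gball n -> adj N x y -> y \in gball n.+1.
Proof.
move=> xn xy /=; rewrite inE; apply/orP; right.
by apply/bigfcupP; exists x; rewrite ?xn ?mem_nbrs.
Qed.

Lemma nbrs_ball n x : x \in gball n -> nbrs x `<=` gball n.+1.
Proof. by move=> xn; apply/fsubsetP => y; rewrite mem_nbrs; exact: ball_step. Qed.

Lemma ballSP n x : x \in gball n.+1 ->
  x \in gball n \/ exists2 y, y \in gball n & adj N y x.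
Proof.
rewrite /= inE => /orP[->|/bigfcupP[y]]; first by left.
by rewrite andbT mem_nbrs => yn yx; right; exists y.
Qed.

Lemma subset_ball m n : (m <= n)%N -> gball m `<=` gball n.
Proof.
move=> /subnK <-; elim: (n - m)%N => [|k IH]; first by rewrite add0n.
by apply: (fsubset_trans IH); rewrite addSn /= fsubsetUl.
Qed.

Lemma mem_ball m n x : (m <= n)%N -> x \in gball m -> x \in gball n.
Proof. by move=> /subset_ball/fsubsetP; apply. Qed.

Lemma ball_exhausts x : exists n, x \in gball n.
Proof.
have [s [ps <-]] := adj_connected N o x.
suff : forall n y, y \in gball n -> path (adj N) y s -> exists n, last y s \in gball n.
  by apply; [exact: (ball_o 0)|].
elim: s {ps x} => [|z s IH] n y yn /=; first by exists n.
by move=> /andP[yz]; apply: IH (ball_step yn yz).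
Qed.

Lemma energyC A f g : energy A f g = energy A g f.
Proof. by do 2![apply: eq_bigr => ? _]; rewrite [X in _ * X]mulrC. Qed.

Lemma energyDr A f g h : energy A f (g \+ h) = energy A f g + energy A f h.
Proof.
rewrite /energy -big_split; apply: eq_bigr => x _; rewrite -big_split.
by apply: eq_bigr => y _ /=; ring.
Qed.

Lemma energyZr A f a g : energy A f (a \*o g) = a * energy A f g.
Proof.
rewrite /energy mulr_sumr; apply: eq_bigr => x _; rewrite mulr_sumr.
by apply: eq_bigr => y _ /=; ring.
Qed.

Lemma energyDl A f g h : energy A (f \+ g) h = energy A f h + energy A g h.
Proof. by rewrite energyC energyDr !(energyC _ h). Qed.

Lemma energyZl A f a g : energy A (a \*o f) g = a * energy A f g.
Proof. by rewrite energyC energyZr energyC. Qed.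

Lemma ler_energy A f1 g1 f2 g2 :
  (forall x y, (f1 y - f1 x) * (g1 y - g1 x) <= (f2 y - f2 x) * (g2 y - g2 x)) ->
  energy A f1 g1 <= energy A f2 g2.
Proof.
move=> h; apply: ler_sum => x _; apply: ler_sum => y _.
by apply: ler_wpM2l; [exact: weight_ge0|exact: h].
Qed.

Lemma energy_ge0 A f : 0 <= energy A f f.
Proof.
apply: sumr_ge0 => x _; apply: sumr_ge0 => y _.
by rewrite mulr_ge0 ?weight_ge0// -expr2 sqr_ge0.
Qed.

(** Discrete Green formula. No boundary term appears, since [lap A] sees only edges inside [A]; the
    factor 2 is the double counting of edges. *)
Lemma energy_parts A f g :
  energy A f g = - 2 * \sum_(x <- A) f x * lap A g x.
Proof.
pose S := \sum_(x <- A) \sum_(y <- A) f x * (weight x y * (g y - g x)).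
have -> : \sum_(x <- A) f x * lap A g x = S.
  by apply: eq_bigr => x _; rewrite mulr_sumr.
(* Swapping the endpoints of an edge keeps its weight and reverses the sign of the difference. *)
have E : \sum_(x <- A) \sum_(y <- A) f y * (weight x y * (g y - g x)) = - S.
  rewrite exchange_big /S -sumrN; apply: eq_bigr => x _.
  by rewrite -sumrN; apply: eq_bigr => y _; rewrite weightC; ring.
transitivity (- S - S); last by ring.
rewrite -{1}E /S -sumrB; apply: eq_bigr => x _.
by rewrite -sumrB; apply: eq_bigr => y _; ring.
Qed.

(** Zero energy forces equality across every edge of the ball, and each vertex of the ball is joined
    to [o] through smaller balls. *)
Lemma energy0_const n f : energy (gball n) f f = 0 ->
  forall x, x \in gball n -> f x = f o.
Proof.
move=> e0.
have ed x y : x \in gball n -> y \in gball n -> adj N x y -> f y = f x.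
  move=> xn yn xy.
  have t0 x' y' : 0 <= weight x' y' * ((f y' - f x') * (f y' - f x')).
    by rewrite mulr_ge0 ?weight_ge0// -expr2 sqr_ge0.
  have /eqP := e0; rewrite /energy big_seq psumr_eq0; last first.
    by move=> x' _; apply: sumr_ge0.
  move=> /allP/(_ x xn); rewrite xn/= big_seq psumr_eq0//.
  move=> /allP/(_ y yn); rewrite yn/= mulf_eq0 (gt_eqF (weight_gt0 xy))/=.
  by rewrite mulf_eq0 orbb subr_eq0 => /eqP.
suff : forall k, (k <= n)%N -> forall x, x \in gball k -> f x = f o by apply.
elim=> [_ x|k IH kn x]; first by rewrite inE => /eqP ->.
move=> xk; case/ballSP: (xk) => [|[y yk yx]]; first exact: IH (ltnW kn) _.
rewrite (ed y x)//; first exact: IH (ltnW kn) _ yk.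
  by apply: mem_ball yk; exact: ltnW.
exact: mem_ball xk.
Qed.

End Network.

(** * Linear systems and the Neumann problem on balls *)

Lemma injective_linear_system (R : fieldType) (I : finType) (M : I -> I -> R) :
  (forall f : I -> R, (forall i, \sum_j M i j * f j = 0) -> forall i, f i = 0) ->
  forall b : I -> R, exists f : I -> R, forall i, \sum_j M i j * f j = b i.
Proof.
move=> inj b; pose A : 'M[R]_#|I| := \matrix_(i, j) M (enum_val j) (enum_val i).
have sumE (v : 'rV_#|I|) i :
    (v *m A) 0 (enum_rank i) = \sum_j M i j * v 0 (enum_rank j).
  rewrite mxE (reindex_onto enum_rank enum_val) /=; last first.
    by move=> j _; rewrite enum_valK.
  rewrite (eq_bigl predT) => [|j]; last by rewrite enum_rankK eqxx.
  by apply: eq_bigr => j _; rewrite mxE !enum_rankK mulrC.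
have uA : A \in unitmx.
  rewrite unitmxE unitfE; apply/det0P => -[v v0 vA].
  case/eqP: v0; apply/rowP => j; rewrite mxE -(enum_valK j).
  apply: (inj (fun i => v 0 (enum_rank i))) => i.
  by rewrite -sumE vA mxE.
pose v := (\row_j b (enum_val j)) *m invmx A.
exists (fun i => v 0 (enum_rank i)) => i.
by rewrite -sumE mulmxKV// mxE enum_rankK.
Qed.

Section Green.
Context (R : realType) (V : choiceType) (N : network R V) (o : V).

Local Notation gball := (gball N o).
Local Notation lap := (lap N).
Local Notation energy := (energy N).

(** [g] solves the Neumann problem with unit sink at [o] and source [nu] in the
    subnetwork induced by [gball m]. *)
Definition neumann (m : nat) (nu g : V -> R) : Prop :=
  [/\ forall x, 0 <= g x, g o = 0 &
      forall x, x \in gball m -> lap (gball m) g x = (x == o)%:R - nu x].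

Lemma sum_lap (A : {fset V}) (f : V -> R) : \sum_(x <- A) lap A f x = 0.
Proof.
have := energy_parts N A (fun=> 1) f.
under [X in _ = _ * X]eq_bigr do rewrite mul1r.
move=> e; suff : energy A (fun=> 1) f = 0 by rewrite e; lra.
by rewrite /energy big1// => x _; rewrite big1// => y _; rewrite subrr mul0r mulr0.
Qed.

(** The equation at [o] is replaced by [g o = 0], which makes the system injective; it is recovered
    at the end because the Laplacian sums to 0 and [nu] has mass 1. *)
Lemma neumann_exists m (nu : V -> R) :
  (forall x, 0 <= nu x) -> nu o = 0 -> \sum_(x <- gball m) nu x = 1 ->
  exists g, neumann m nu g.
Proof.
move=> nu0 nuo nu1; set A := gball m.
have oA : o \in A := ball_o N o m.
pose ext (f : A -> R) (x : V) : R := if insub x is Some i then f i else 0.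
have extE f i : ext f (val i) = f i by rewrite /ext valK.
(* The row of [o] is the normalization; the other rows are the Laplacian with its diagonal entry
   written out. *)
pose M (i j : A) : R := if val i == o then (val j == o)%:R else
  weight N (val i) (val j) - (i == j)%:R * \sum_(y <- A) weight N (val i) y.
have ME f i : \sum_j M i j * f j =
    if val i == o then ext f o else lap A (ext f) (val i).
  case: ifP => [/eqP io|io].
    rewrite (bigD1 i)//= /M io eqxx mul1r -{2}io extE big1 ?addr0// => j ji.
    by rewrite -io (inj_eq val_inj) (negbTE ji) mul0r.
  rewrite /M io /lap; under eq_bigr do rewrite mulrBl.
  rewrite sumrB [X in _ - X](bigD1 i)//= eqxx mul1r.
  rewrite [X in _ - (_ + X)]big1 ?addr0; last first.
    by move=> j; rewrite eq_sym => /negbTE ->; rewrite !mul0r.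
  under [RHS]eq_bigr do rewrite mulrBr.
  rewrite [RHS]sumrB -mulr_suml extE; congr (_ - _).
  rewrite big_seq_fsetE/=; apply: eq_bigr => j _; by rewrite extE.
have lap_parts (f : V -> R) : f o = 0 -> forall g k,
    (forall x, x \in A -> x != o -> lap A g x = k x) ->
    \sum_(x <- A) f x * lap A g x = \sum_(x <- A) f x * k x.
  move=> fo g k gk; apply: eq_big_seq => x xA.
  by have [->|xo] := eqVneq x o; [rewrite fo !mul0r|rewrite gk].
have [f Mf] : exists f : A -> R, forall i,
    \sum_j M i j * f j = if val i == o then 0 else - nu (val i).
  apply: injective_linear_system => f Mf0 i; rewrite -extE.
  (* A solution of the homogeneous system has zero energy, so it is constant and equal to its value
     0 at [o]. *)
  have fo : ext f o = 0 by have := Mf0 [` oA]; rewrite ME /= eqxx.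
  have en : energy A (ext f) (ext f) = 0.
    rewrite energy_parts (lap_parts _ fo _ (fun=> 0)) => [|x xA xo].
      by rewrite big1 ?mulr0// => *; rewrite mulr0.
    by have := Mf0 [` xA]; rewrite ME /= (negbTE xo).
  by rewrite (energy0_const en (fsvalP i)).
pose g := ext f.
have go : g o = 0 by have := Mf [` oA]; rewrite ME /= eqxx.
have glap x : x \in A -> x != o -> lap A g x = - nu x.
  by move=> xA xo; have := Mf [` xA]; rewrite ME /= (negbTE xo).
exists g; split=> //.
(* Minimum principle: the energy of the negative part [n] is at most its mutual energy with [g],
   which is nonpositive as [nu] is nonnegative; hence [n] is constant, equal to [n o = 0]. *)
- pose n x := Num.min (g x) 0.
  have no : n o = 0 by rewrite /n go minxx.
  have n_le0 x : n x <= 0 by rewrite /n ge_min lexx orbT.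
  have en : energy A n n <= 0.
    apply: (@le_trans _ _ (energy A n g)).
      apply: ler_energy => x y; rewrite /n.
      by case: (lerP (g x) 0) => ?; case: (lerP (g y) 0) => ?; nra.
    rewrite energy_parts (lap_parts _ no _ _ glap).
    suff : 0 <= \sum_(x <- A) n x * - nu x by lra.
    by apply: sumr_ge0 => x _; have := n_le0 x; have := nu0 x; nra.
  have {}en : energy A n n = 0 by apply/eqP; rewrite eq_le en energy_ge0.
  move=> x; have [xA|xA] := boolP (x \in A); last first.
    by rewrite /g /ext; case: insubP => // -[y yA] yA' yx; rewrite -yx /= yA in xA.
  have := energy0_const en xA; rewrite no /n.
  by case: (lerP (g x) 0) => [_ ->|/ltW gx0 _].
- move=> x xA; have [->|xo] := eqVneq x o; last by rewrite glap// sub0r.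
  have := sum_lap A g; rewrite (big_fsetD1 o)//= nuo subr0.
  rewrite (eq_big_seq (fun x => - nu x)) => [|y]; last first.
    by rewrite in_fsetD1 => /andP[yo yA]; exact: glap.
  rewrite sumrN; move: nu1; rewrite (big_fsetD1 o)//= nuo.
  by lra.
Qed.

End Green.

(** * Energy of truncated Neumann solutions, and a Harnack bound *)

Section Energy.
Context (R : realType) (V : choiceType) (N : network R V) (o : V).

Local Notation gball := (gball N o).
Local Notation lap := (lap N).
Local Notation energy := (energy N).

Lemma energy_neumann m (nu g f : V -> R) : neumann N o m nu g -> f o = 0 ->
  energy (gball m) f g = 2 * \sum_(x <- gball m) f x * nu x.
Proof.
move=> [_ _ gl] fo; rewrite energy_parts mulNr -mulrN -sumrN; congr (_ * _).
apply: eq_big_seq => x xm; rewrite gl//.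
by have [->|xo] := eqVneq x o; [rewrite fo !mul0r oppr0|rewrite sub0r mulrN opprK].
Qed.

Definition trunc (t : R) (g : V -> R) : V -> R := fun x => Num.min (g x) t.

Lemma trunc_le t g x : trunc t g x <= g x.
Proof. by rewrite /trunc ge_min lexx. Qed.

Lemma trunc_o m nu g t : neumann N o m nu g -> 0 <= t -> trunc t g o = 0.
Proof. by move=> [_ go _] t0; rewrite /trunc go min_l. Qed.

(** Replacing one factor by [g] does not decrease the energy, which then is twice the [nu]-average
    of a function bounded by [t]. *)
Lemma energy_trunc m nu g t : neumann N o m nu g -> (forall x, 0 <= nu x) ->
  \sum_(x <- gball m) nu x = 1 -> 0 <= t ->
  energy (gball m) (trunc t g) (trunc t g) <= 2 * t.
Proof.
move=> gN nu0 nu1 t0; apply: (@le_trans _ _ (energy (gball m) (trunc t g) g)).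
  apply: ler_energy => x y; rewrite /trunc.
  by case: (lerP (g x) t) => ?; case: (lerP (g y) t) => ?; nra.
rewrite (energy_neumann gN (trunc_o gN t0)) ler_pM2l//.
rewrite -[leRHS]mulr1 -nu1 mulr_sumr; apply: ler_sum => x _.
by apply: ler_wpM2r => //; rewrite /trunc ge_min lexx orbT.
Qed.

(** A minimum of superharmonic functions is superharmonic; here one of them is constant. *)
Lemma lap_trunc (A : {fset V}) g t x : lap A g x <= 0 -> lap A (trunc t g) x <= 0.
Proof.
move=> gx; rewrite /trunc; have [xt|xt] := lerP (g x) t.
  apply: le_trans gx; apply: ler_sum => y _; apply: ler_wpM2l.
    exact: weight_ge0.
  by rewrite (min_l xt) lerD2r ge_min lexx.
apply: sumr_le0 => y _.
by rewrite (min_r (ltW xt)) mulr_ge0_le0 ?weight_ge0// subr_le0 ge_min lexx orbT.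
Qed.

(* [trunc t g2] is superharmonic off [o], so replacing the other factor
   [trunc t g1] by the larger [g1] increases the mutual energy. *)
Lemma energy_trunc2 m nu1 nu2 g1 g2 t :
  neumann N o m nu1 g1 -> neumann N o m nu2 g2 ->
  (forall x, 0 <= nu1 x) -> (forall x, 0 <= nu2 x) -> 0 <= t ->
  energy (gball m) (trunc t g2) (trunc t g1) <=
    2 * \sum_(x <- gball m) g2 x * nu1 x.
Proof.
move=> gN1 gN2 nu10 nu20 t0.
apply: (@le_trans _ _ (energy (gball m) (trunc t g2) g1)); last first.
  rewrite (energy_neumann gN1 (trunc_o gN2 t0)) ler_pM2l//.
  by apply: ler_sum => x _; apply: ler_wpM2r => //; exact: trunc_le.
pose d x := g1 x - trunc t g1 x.
have gE : g1 = trunc t g1 \+ d by apply/funext => x; rewrite /d /=; ring.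
rewrite [X in _ <= energy _ _ X]gE energyDr lerDl energyC energy_parts.
suff : \sum_(x <- gball m) d x * lap (gball m) (trunc t g2) x <= 0 by lra.
have [_ g1o _] := gN1; have [_ _ g2l] := gN2.
rewrite big_seq; apply: sumr_le0 => x xm.
have [->|xo] := eqVneq x o; first by rewrite /d (trunc_o gN1 t0) g1o subrr mul0r.
rewrite mulr_ge0_le0//; first by rewrite /d subr_ge0 trunc_le.
by apply: lap_trunc; rewrite g2l// (negbTE xo) sub0r oppr_le0.
Qed.

(** Bilinear expansion: there are [size s] diagonal terms and at most [size s ^ 2] others. By
    symmetry of the energy, bounding each pair in one order is enough. *)
Lemma energy_sum_pairwise (A : {fset V}) (I : eqType) (u : I -> V -> R)
    (s : seq I) (t L : R) : 0 <= L ->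
  (forall i, i \in s -> energy A (u i) (u i) <= 2 * t) ->
  pairwise (fun i j => energy A (u i) (u j) <= 2 * L) s ->
  let F := fun x => \sum_(i <- s) u i x in
  energy A F F <= 2 * ((size s)%:R * t + (size s)%:R ^+ 2 * L).
Proof.
move=> L0; elim: s => [|i s IH] diag /=.
  move=> _; rewrite /energy big1 => [|x _]; first by lra.
  by rewrite big1// => y _; rewrite !big_nil subrr !mul0r mulr0.
move=> /andP[row pw].
pose F x := \sum_(j <- s) u j x.
have -> : (fun x => \sum_(j <- i :: s) u j x) = u i \+ F.
  by apply/funext => x; rewrite big_cons.
have iF : energy A (u i) F <= 2 * ((size s)%:R * L).
  rewrite /F; elim: s row {pw IH diag F} => [_|j s IH /= /andP[ij row]].
    rewrite /energy big1 => [|x _]; first by rewrite /=; lra.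
    by rewrite big1// => y _; rewrite !big_nil subrr !mulr0.
  have -> : (fun x => \sum_(k <- j :: s) u k x) =
      u j \+ (fun x => \sum_(k <- s) u k x).
    by apply/funext => x; rewrite big_cons.
  by rewrite energyDr -natr1; have := IH row; lra.
rewrite energyDl !energyDr (energyC _ _ F) -natr1.
have ii := diag i (mem_head _ _).
have FF : energy A F F <= 2 * ((size s)%:R * t + (size s)%:R ^+ 2 * L).
  by apply: IH => // j js; apply: diag; rewrite inE js orbT.
by have := ler0n R (size s); nra.
Qed.

(** Induction on the distance from [o]: if [f y <= C], then [f >= 0] and a Laplacian at most 1 at
    [y] bound [weight N y v * f v] by [1 + C * W]. *)
Lemma harnack (v : V) : exists M, exists2 C, 0 <= C & forall f : V -> R,
  (forall x, 0 <= f x) -> f o = 0 ->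
  (forall x, x \in gball M -> laplacian N f x <= 1) -> f v <= C.
Proof.
have [M vM] := ball_exhausts N o v; exists M.
elim: M v vM => [v|M IH v /ballSP[/IH[C C0 CP]|[y yM yv]]].
- by rewrite inE => /eqP ->; exists 0 => // f _ ->.
- exists C => // f f0 fo fl; apply: CP => // x xM.
  by apply: fl; exact: mem_ball xM.
have [C C0 CP] := IH _ yM; have wyv := weight_gt0 yv.
pose W := \sum_(z <- nbrs N y) weight N y z.
have W0 : 0 <= W by apply: sumr_ge0 => z _; exact: weight_ge0.
exists ((1 + C * W) / weight N y v) => [|f f0 fo fl].
  by rewrite divr_ge0 ?(ltW wyv)// addr_ge0// mulr_ge0.
have fy : f y <= C.
  by apply: CP => // x xM; apply: fl; exact: mem_ball xM.
rewrite ler_pdivlMr//.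
have := fl y (mem_ball (leqnSn M) yM); rewrite (laplacianE (A := nbrs N y)) ?fsubset_refl// /lap.
have vn : v \in nbrs N y by rewrite mem_nbrs.
rewrite /W !(big_fsetD1 v vn)/= mulrDr.
suff : - (C * (\sum_(z <- nbrs N y `\ v) weight N y z)) <=
    \sum_(z <- nbrs N y `\ v) weight N y z * (f z - f y) by nra.
rewrite mulr_sumr -sumrN; apply: ler_sum => z _.
by have := weight_ge0 N y z; have := f0 z; nra.
Qed.

End Energy.

(** * Hitting probabilities as test functions of small energy *)

Section HittingProbabilities.
Context (R : realType) (V : choiceType) (N : network R V) (o : V).

Lemma nbrs_nonempty x : exists y, adj N x y.
Proof.
apply: contrapT => none; apply: (vertices_infinite N).
suff -> : [set: V] = [set x] by exact: finite_set1.
apply/seteqP; split=> // y _ /=.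
have [[|z s] [ps <-]//] := adj_connected N x y.
by case: none; exists z; case/andP: ps.
Qed.

Lemma vertex_condE x : vertex_cond N x = \sum_(y <- nbrs N x) weight N x y.
Proof.
rewrite /vertex_cond fsbig_finite; last exact: adj_locally_finite.
apply: eq_big_seq => y; rewrite -/(nbrs N x) mem_nbrs => xy.
by rewrite /weight xy.
Qed.

Lemma vertex_cond_gt0 x : 0 < vertex_cond N x.
Proof.
have [y xy] := nbrs_nonempty x.
rewrite vertex_condE (big_fsetD1 y) ?mem_nbrs//= ltr_pwDl ?weight_gt0//.
by apply: sumr_ge0 => z _; exact: weight_ge0.
Qed.

Lemma transE x y : vertex_cond N x * trans N x y = weight N x y.
Proof.
rewrite /trans /weight; case: ifP => _; last by rewrite mulr0.
by rewrite mulrC divfK// gt_eqF// vertex_cond_gt0.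
Qed.

Lemma trans_ge0 x y : 0 <= trans N x y.
Proof. by rewrite -(pmulr_rge0 _ (vertex_cond_gt0 x)) transE weight_ge0. Qed.

(** The probability that the walk from [x] visits [o] within [n] steps. *)
Fixpoint hit (n : nat) (x : V) : R :=
  if x == o then 1
  else if n is m.+1 then \sum_(y <- nbrs N x) trans N x y * hit m y else 0.

Lemma sum_trans x : \sum_(y <- nbrs N x) trans N x y = 1.
Proof.
have c0 := vertex_cond_gt0 x; apply: (@mulfI _ (vertex_cond N x)).
  by rewrite gt_eqF.
by rewrite mulr1 mulr_sumr [RHS]vertex_condE; under eq_bigr do rewrite transE.
Qed.

Lemma hit_o n : hit n o = 1.
Proof. by case: n => [|n] /=; rewrite eqxx. Qed.

Lemma hit_ge0 n x : 0 <= hit n x.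
Proof.
elim: n x => [|n IH] x /=; case: ifP => // _.
by apply: sumr_ge0 => y _; rewrite mulr_ge0 ?trans_ge0.
Qed.

Lemma hit_le n x : hit n x <= hit n.+1 x.
Proof.
elim: n x => [|n IH] x; first by rewrite /=; case: ifP => // _;
  apply: sumr_ge0 => y _; rewrite mulr_ge0 ?trans_ge0//; exact: (hit_ge0 0).
rewrite /= -/(hit n.+1); case: ifP => // _; apply: ler_sum => y _.
by apply: ler_wpM2l; [exact: trans_ge0|exact: IH].
Qed.

Lemma hit_supp n x : x \notin gball N o n -> hit n x = 0.
Proof.
elim: n x => [|n IH] x; first by rewrite !inE /= => /negbTE ->.
move=> xn /=; case: eqP => [xo|_]; first by rewrite xo ball_o in xn.
rewrite big_seq big1// => y; rewrite mem_nbrs => xy; rewrite IH ?mulr0//.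
by apply: contra xn => /ball_step; apply; rewrite (adj_sym N).
Qed.

(** Off [o] the bracket is [hit n.+1 x - hit n x], hence nonnegative; at [o] it is minus the
    probability of not returning within [n.+1] steps. *)
Lemma lap_hit n x : x \in gball N o n ->
  lap N (gball N o n.+1) (hit n) x =
  vertex_cond N x * (\sum_(y <- nbrs N x) trans N x y * hit n y - hit n x).
Proof.
move=> xn; rewrite -laplacianE ?nbrs_ball//.
rewrite (laplacianE (A := nbrs N x)) ?fsubset_refl// /lap.
have e : hit n x = \sum_(y <- nbrs N x) trans N x y * hit n x.
  by rewrite -mulr_suml sum_trans mul1r.
rewrite [X in _ = _ * (_ - X)]e -sumrB mulr_sumr.
by apply: eq_bigr => y _; rewrite -transE; ring.
Qed.

(** In the Green formula every vertex other than [o] contributes with a favourable sign: there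
    [hit n] vanishes or has a nonnegative Laplacian. *)
Lemma energy_hit n : energy N (gball N o n.+1) (hit n) (hit n) <=
  2 * (vertex_cond N o * (1 - \sum_(y <- nbrs N o) trans N o y * hit n y)).
Proof.
rewrite energy_parts (big_fsetD1 o) ?ball_o//=.
rewrite lap_hit ?ball_o// hit_o.
suff : 0 <= \sum_(x <- gball N o n.+1 `\ o) hit n x * lap N (gball N o n.+1) (hit n) x.
  by rewrite /=; lra.
rewrite big_seq; apply: sumr_ge0 => x; rewrite in_fsetD1 => /andP[xo _].
have [xn|/hit_supp ->] := boolP (x \in gball N o n); last by rewrite mul0r.
rewrite lap_hit// mulr_ge0 ?hit_ge0// mulr_ge0 ?(ltW (vertex_cond_gt0 _))//.
by rewrite subr_ge0; have := hit_le n x; rewrite /= (negbTE xo).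
Qed.

(** * Comparison of the random walk with the recursion for [hit] *)

Section Walk.
Local Open Scope classical_set_scope.
Local Open Scope ring_scope.
Context (v : V) (d : measure_display) (Omega : measurableType d)
  (P : probability Omega R) (X : nat -> Omega -> V).
Hypothesis walkX : network_walk N v P X.

Definition cylinder (k : nat) (x : nat -> V) : set Omega :=
  [set w | forall i : nat, (i <= k)%N -> X i w = x i].

Definition visits (k n : nat) : set Omega :=
  [set w | exists2 i : nat, (k <= i <= k + n)%N & X i w = o].

Definition path_upd (x : nat -> V) (k : nat) (y : V) : nat -> V :=
  fun i => if i == k then y else x i.

Lemma measurable_cylinder k x : measurable (cylinder k x).
Proof.
have [mX _ _] := walkX.
have -> : cylinder k x = \bigcap_(i in [set i | (i <= k)%N]) X i @^-1` [set x i].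
  by apply/seteqP; split.
by apply: bigcap_measurable => //; exists 0%N.
Qed.

Lemma measurable_visits k n : measurable (visits k n).
Proof.
have [mX _ _] := walkX.
have -> : visits k n =
    \bigcup_(i in [set i | (k <= i <= k + n)%N]) X i @^-1` [set o].
  by apply/seteqP; split.
exact: bigcup_measurable.
Qed.

Lemma cylinder_upd k x y :
  P (cylinder k.+1 (path_upd x k.+1 y)) = (P (cylinder k x) * (trans N (x k) y)%:E)%E.
Proof.
have [_ _ markov] := walkX; rewrite markov /path_upd eqxx ltn_eqF//.
congr (P _ * _)%E; apply/seteqP; split=> w /= h i ik; have := h i ik;
  by rewrite ltn_eqF.
Qed.

Lemma trivIset_cylinder k x (E : set Omega) :
  trivIset (neighbours N (x k)) (fun y => cylinder k.+1 (path_upd x k.+1 y) `&` E).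
Proof.
move=> y z _ _ [w [[hy _] [hz _]]].
by have := hy _ (leqnn _); rewrite (hz _ (leqnn _)) /path_upd eqxx.
Qed.

(** The transition probabilities to the finitely many neighbours of [x k] sum to 1, so the extended
    cylinders carry all the mass of [cylinder k x] and what they miss is a null set. *)
Lemma cylinder_step k x (E : set Omega) : measurable E ->
  (P (cylinder k x `&` E) <=
   \sum_(y <- nbrs N (x k)) P (cylinder k.+1 (path_upd x k.+1 y) `&` E))%E.
Proof.
move=> mE; pose C y := cylinder k.+1 (path_upd x k.+1 y).
have mC y : measurable (C y) by exact: measurable_cylinder.
have fin := adj_locally_finite N (x k).
have add (F : set Omega) : measurable F ->
    P (\bigcup_(y in neighbours N (x k)) (C y `&` F)) =
    (\sum_(y <- nbrs N (x k)) P (C y `&` F))%E.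
  move=> mF; rewrite measure_fin_bigcup//; first by rewrite fsbig_finite.
    exact: trivIset_cylinder.
  by move=> y _; exact: measurableI.
pose U := \bigcup_(y in neighbours N (x k)) (C y `&` setT).
have mU : measurable U.
  by apply: fin_bigcup_measurable => // y _; exact: measurableI.
have subU : U `<=` cylinder k x.
  move=> w [y _ [wy _]] i ik; rewrite wy ?(leqW ik)//.
  by rewrite /path_upd ltn_eqF.
have PU : P U = P (cylinder k x).
  rewrite add//; under eq_bigr do rewrite setIT cylinder_upd.
  rewrite -ge0_sume_distrr; last by move=> y _; rewrite lee_fin trans_ge0.
  by rewrite sumEFin sum_trans mule1.
have null : P (cylinder k x `\` U) = 0%E.
  rewrite measureD//; [|exact: measurable_cylinder|].
    rewrite setIidr//; transitivity (P (cylinder k x) - P (cylinder k x))%E.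
      by congr (_ - _)%E; exact: PU.
    by rewrite subee// fin_num_measure//; exact: measurable_cylinder.
  by rewrite (le_lt_trans (probability_le1 _ _))// ?ltry//; exact: measurable_cylinder.
rewrite -add//.
have mB : measurable (\bigcup_(y in neighbours N (x k)) (C y `&` E)).
  by apply: fin_bigcup_measurable => // y _; exact: measurableI.
have mD : measurable (cylinder k x `\` U).
  by apply: measurableD => //; exact: measurable_cylinder.
rewrite -(measureU0 mB mD null); apply: le_measure; rewrite ?inE.
- by apply: measurableI => //; exact: measurable_cylinder.
- exact: measurableU.
- move=> w [wx wE]; have [[y ky [wy _]]|nU] := pselect (U w).
    by left; exists y.
  by right.
Qed.

Lemma visits_shift k n (x : nat -> V) : x k <> o ->
  cylinder k x `&` visits k n.+1 = cylinder k x `&` visits k.+1 n.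
Proof.
move=> xo; apply/seteqP; split=> w [wx [i ki Xi]]; split=> //; exists i => //.
- rewrite addSn -addnS; case/andP: ki; rewrite leq_eqVlt => /orP[/eqP ki|-> -> //].
  by case: xo; rewrite -Xi -ki wx.
- by move: ki; rewrite addSn -addnS => /andP[/ltnW -> ->].
Qed.

Lemma prob_visits_le k n (x : nat -> V) :
  (P (cylinder k x `&` visits k n) <= P (cylinder k x) * (hit n (x k))%:E)%E.
Proof.
have mc := measurable_cylinder.
have le1 k' x' n' : (P (cylinder k' x' `&` visits k' n') <= P (cylinder k' x'))%E.
  apply: le_measure; rewrite ?inE//.
  by apply: measurableI => //; exact: measurable_visits.
elim: n k x => [|n IH] k x; have [xo|/eqP xo] := eqVneq (x k) o.
- by rewrite xo hit_o mule1; exact: le1.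
- rewrite (_ : _ `&` _ = set0) ?measure0 ?mule_ge0 ?lee_fin ?hit_ge0//.
  apply/seteqP; split=> // w [wx [i]]; rewrite addn0 -eqn_leq => /eqP <-.
  by rewrite wx.
- by rewrite xo hit_o mule1; exact: le1.
rewrite visits_shift//; apply: le_trans (cylinder_step _ _ _) _.
  exact: measurable_visits.
rewrite /= (introF eqP xo) -sumEFin ge0_sume_distrr; last first.
  by move=> y _; rewrite lee_fin mulr_ge0 ?trans_ge0 ?hit_ge0.
apply: lee_sum => y _; apply: le_trans (IH _ _) _.
by rewrite cylinder_upd /path_upd eqxx EFinM muleA.
Qed.

(** The first step is split off before comparing with [hit], because [hit] counts a visit at time 0
    and a return does not. *)
Lemma prob_return_le n :
  (P (visits 1 n) <= (\sum_(y <- nbrs N v) trans N v y * hit n y)%:E)%E.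
Proof.
have [mX X0 _] := walkX; pose x0 : nat -> V := fun=> v.
have C0 : cylinder 0 x0 = X 0%N @^-1` [set v].
  apply/seteqP; split=> w /=; first exact.
  by move=> Xw i; rewrite leqn0 => /eqP ->.
have mc := measurable_cylinder; have mv := measurable_visits 1 n.
have null : P (~` cylinder 0 x0) = 0%E.
  by rewrite probability_setC// C0 X0 subee.
have mI : measurable (cylinder 0 x0 `&` visits 1 n) by exact: measurableI.
have mCc : measurable (~` cylinder 0 x0) by exact: measurableC.
have : (P (visits 1 n) <= P (cylinder 0 x0 `&` visits 1 n))%E.
  rewrite -(measureU0 mI mCc null); apply: le_measure; rewrite ?inE//.
    exact: measurableU.
  by move=> w wv; case: (pselect (cylinder 0 x0 w)); [left|right].
move/le_trans; apply.
apply: le_trans (cylinder_step _ _ mv) _.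
rewrite -sumEFin; apply: lee_sum => y _; apply: le_trans (prob_visits_le _ _ _) _.
by rewrite cylinder_upd C0 X0 mul1e /path_upd eqxx EFinM.
Qed.

End Walk.

Lemma recurrent_test_function : recurrent N -> forall e : R, 0 < e ->
  exists n (phi : V -> R), [/\ phi o = 1, forall x, x \notin gball N o n -> phi x = 0 &
    energy N (gball N o n.+1) phi phi <= 2 * e].
Proof.
move=> hrec e e0; case: (hrec o) => d [T [P [X [wX ret]]]].
(* If the probability of not returning stayed above [e / vertex_cond N o], continuity from below
   would keep the probability of ever returning away from 1. *)
have [n nP] : exists n, 1 - \sum_(y <- nbrs N o) trans N o y * hit n y
    <= e / vertex_cond N o.
  apply: contrapT => none.
  have bound n : (P (visits X 1 n) <= (1 - e / vertex_cond N o)%:E)%E.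
    apply: le_trans (prob_return_le wX n) _; rewrite lee_fin.
    have : ~ (1 - \sum_(y <- nbrs N o) trans N o y * hit n y <= e / vertex_cond N o).
      by move=> ?; apply: none; exists n.
    by move/negP; rewrite -ltNge; lra.
  have mv n : measurable (visits X 1 n) := measurable_visits wX 1 n.
  have retE : [set w | exists2 n : nat, (0 < n)%N & X n w = o] =
      (\bigcup_n visits X 1 n)%classic.
    apply/seteqP; split=> w /=; last by move=> [n _ [i /andP[i0 _] Xi]]; exists i.
    by move=> [i i0 Xi]; exists i => //; exists i => //; rewrite i0 add1n leqnSn.
  have cv : P (visits X 1 n) @[n --> \oo] --> 1%E.
    rewrite -ret retE; apply: nondecreasing_cvg_mu => //.
      exact: bigcup_measurable.
    move=> m n mn; apply/subsetPset => w [i /andP[i0 im] Xi]; exists i => //.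
    by rewrite i0 (leq_trans im)// leq_add2l.
  have : (1%E <= (1 - e / vertex_cond N o)%:E)%E.
    rewrite -(cvg_lim _ cv)//; apply: lime_le; first exact: cvgP cv.
    exact: nearW.
  rewrite lee_fin.
  by have := divr_gt0 e0 (vertex_cond_gt0 o); lra.
exists n, (hit n); split; [exact: hit_o|exact: hit_supp|].
apply: le_trans (energy_hit n) _; rewrite ler_pM2l//.
by rewrite mulrC -ler_pdivlMr// vertex_cond_gt0.
Qed.

End HittingProbabilities.

(** * Ultralimits of potentials and Green potentials *)

Section FreeUltrafilter.
Local Open Scope classical_set_scope.
Local Open Scope ring_scope.
Context (R : realType) (V : choiceType) (N : network R V) (o : V).
Context (U : set_system nat) {UU : UltraFilter U} (Uoo : \oo `<=` U).

Lemma near_seq (I : eqType) (s : seq I) (P : nat -> I -> Prop) :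
  (forall i, i \in s -> \forall n \near U, P n i) ->
  \forall n \near U, forall i, i \in s -> P n i.
Proof.
elim: s => [|i s IH] h; first exact: nearW.
have := h i (mem_head _ _).
have := IH (fun j js => h j (mem_behead (s := i :: s) js)).
apply: filter_app2; apply: nearW => n ns ni j.
by rewrite inE => /orP[/eqP ->|/ns].
Qed.

Lemma image_ultrafilter (T : Type) (f : nat -> T) : UltraFilter (f @ U).
Proof.
split=> [|G GF fG]; first exact: fmap_proper_filter.
apply/seteqP; split=> [A GA|]; last exact: fG.
have [//|nA] := in_ultra_setVsetC (f @^-1` A) UU.
have : G (A `&` ~` A) by apply: filterI => //; exact: fG.
by rewrite setICr => /filter_not_empty.
Qed.

(** Compactness of a segment. No subsequence is extracted, so the same [U] serves all vertices at
    once. *)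
Lemma ultralimit (f : nat -> R) C :
  (\forall n \near U, 0 <= f n <= C) -> exists l : R, f n @[n --> U] --> l.
Proof.
move=> fC; have := @segment_compact R 0 C; rewrite compact_ultra.
move=> /(_ _ (image_ultrafilter f))[|l [_ fl]]; last by exists l.
by apply: filterS fC => n; rewrite /= in_itv.
Qed.

Lemma cvg_laplacian (f : nat -> V -> R) (g : V -> R) x :
  (forall v, f n v @[n --> U] --> g v) ->
  laplacian N (f n) x @[n --> U] --> laplacian N g x.
Proof.
have sub := fsubset_refl (nbrs N x).
move=> fg; rewrite (laplacianE _ sub); under eq_cvg do rewrite (laplacianE _ sub).
apply: cvg_big => [|y _]; first exact: add_continuous.
by apply: cvgMr; apply: cvgB.
Qed.

(** The Harnack bound gives pointwise limits, and the Laplacian, a finite sum, passes to them. The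
    equation is required only eventually at each vertex, as it will come from growing balls. *)
Lemma ultralimit_laplacian (f : nat -> V -> R) (b : V -> R) :
  (forall n x, 0 <= f n x) -> (forall n, f n o = 0) -> (forall x, b x <= 1) ->
  (forall x, \forall n \near U, laplacian N (f n) x = b x) ->
  exists g, [/\ forall v, f n v @[n --> U] --> g v, forall v, 0 <= g v, g o = 0 &
    forall x, laplacian N g x = b x].
Proof.
move=> f0 fo b1 fb.
have /choice[g fg] v : exists l : R, f n v @[n --> U] --> l.
  have [M [C C0 CP]] := harnack N o v.
  apply: (@ultralimit _ C).
  have : \forall n \near U, forall x, x \in gball N o M -> laplacian N (f n) x <= 1.
    by apply: near_seq => x _; apply: filterS (fb x) => n ->.
  by apply: filterS => n h; rewrite f0 CP.
exists g; split=> // [v||x].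
- by apply: (ler_cvg_to (cvg_cst 0) (fg v)); exact: nearW.
- apply: (cvg_unique (@norm_hausdorff _ R) (fg o)); rewrite (_ : f ^~ o = fun=> 0); first exact: cvg_cst.
  by apply/funext => n; rewrite fo.
- apply: (cvg_unique (@norm_hausdorff _ R) (cvg_laplacian (x := x) fg)).
  apply: cvg_near_cst; exact: fb.
Qed.

Lemma potential_laplacian h : potential N o h ->
  forall x, laplacian N h x = (x == o)%:R.
Proof. by move=> [_ _ ho hv] x; case: eqP => [->//|/hv]. Qed.

Lemma potentialP h : (forall v, 0 <= h v) -> h o = 0 ->
  (forall x, laplacian N h x = (x == o)%:R) -> potential N o h.
Proof.
move=> h0 ho hl; split=> //; first by rewrite hl eqxx.
by move=> v /eqP vo; rewrite hl (negbTE vo).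
Qed.

Lemma potential_ultralimit (f : nat -> V -> R) : (forall n, potential N o (f n)) ->
  exists2 h, potential N o h & forall v, f n v @[n --> U] --> h v.
Proof.
move=> fP; have [||||h [fh h0 ho hl]] :=
    @ultralimit_laplacian f (fun x => (x == o)%:R).
- by move=> n x; have [] := fP n.
- by move=> n; have [] := fP n.
- by move=> x; case: eqP => _; rewrite ?lexx ?ler01.
- by move=> x; apply: nearW => n; exact: potential_laplacian.
by exists h => //; exact: potentialP.
Qed.

Lemma potential_convex (t : R) g h : 0 <= t <= 1 ->
  potential N o g -> potential N o h ->
  potential N o (fun v => g v + t * (h v - g v)).
Proof.
move=> /andP[t0 t1] gP hP; have [g0 go _ _] := gP; have [h0 ho _ _] := hP.
apply: potentialP => [v||x].
- by have := g0 v; have := h0 v; nra.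
- by rewrite go ho; ring.
transitivity (laplacian N g x + t * (laplacian N h x - laplacian N g x)).
  have fin := adj_locally_finite N x.
  rewrite /laplacian !fsbig_finite// -sumrB mulr_sumr -big_split.
  by apply: eq_bigr => y _ /=; ring.
by rewrite !(potential_laplacian _ x)//; ring.
Qed.

Definition source (m : nat) (nu : V -> R) : Prop :=
  [/\ forall x, 0 <= nu x, nu o = 0, \sum_(x <- gball N o m) nu x = 1 &
      forall x, x \notin gball N o m -> nu x = 0].

Lemma source_sum m n nu (f : V -> R) : source m nu -> (m <= n)%N ->
  \sum_(x <- gball N o n) f x * nu x = \sum_(x <- gball N o m) f x * nu x.
Proof.
move=> [_ _ _ nus] mn; symmetry; apply: big_fset_incl; first exact: subset_ball.
by move=> x _ /nus ->; rewrite mulr0.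
Qed.

Lemma source_le m n nu : source m nu -> (m <= n)%N -> source n nu.
Proof.
move=> nuP mn; have [nu0 nuo nu1 nus] := nuP; split=> //.
- have e k : \sum_(x <- gball N o k) nu x = \sum_(x <- gball N o k) 1 * nu x.
    by apply: eq_bigr => x _; rewrite mul1r.
  by rewrite e (source_sum (fun=> 1) nuP mn) -e.
- by move=> x xn; apply: nus; apply: contra xn; exact: mem_ball.
Qed.

Lemma green_exists m nu : source m nu ->
  exists (gn : nat -> V -> R) g, [/\ forall n, (m <= n)%N -> neumann N o n nu (gn n),
    forall v, gn n v @[n --> U] --> g v, forall v, 0 <= g v, g o = 0 &
    forall x, laplacian N g x = (x == o)%:R - nu x].
Proof.
move=> nuP.
have /choice[gn gnP] n : exists g, [/\ forall x, 0 <= g x, g o = 0 &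
    (m <= n)%N -> neumann N o n nu g].
  (* Below [m] the ball may miss part of [nu]; the zero function is a default that is nonnegative
     and vanishes at [o]. *)
  have [mn|mn] := leqP m n; last by exists (fun=> 0).
  have [nu0 nuo nu1 _] := source_le nuP mn.
  have [g gP] := neumann_exists nu0 nuo nu1.
  by exists g; have [] := gP.
have [nu0 _ _ _] := nuP.
have [||||g [cg g0 go gl]] :=
    @ultralimit_laplacian gn (fun x => (x == o)%:R - nu x).
- by move=> n x; have [] := gnP n.
- by move=> n; have [] := gnP n.
- by move=> x; have := nu0 x; case: eqP => _ /=; lra.
- move=> x; have [k xk] := ball_exhausts N o x.
  (* One radius beyond that of [x], so that all its neighbours lie in the ball. *)
  apply: Uoo; exists (maxn m k.+1) => // n /=; rewrite geq_max => /andP[mn kn].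
  have [_ _ /(_ mn)[_ _ gnl]] := gnP n.
  rewrite (laplacianE (A := gball N o n)); last first.
    by apply: fsubset_trans (nbrs_ball xk) _; exact: subset_ball.
  by rewrite gnl//; apply: mem_ball xk; exact: ltnW.
by exists gn, g; split=> // n mn; have [_ _] := gnP n; exact.
Qed.

End FreeUltrafilter.

(** * A separating source by quadratic minimization *)

Section Minimax.
Local Open Scope classical_set_scope.
Local Open Scope ring_scope.
Context (R : realType) (V : choiceType) (N : network R V) (o : V).
Context (U : set_system nat) {UU : UltraFilter U} (Uoo : \oo `<=` U).
Context (L : R) (B : {fset V}).

Definition deficit (h : V -> R) (x : V) : R :=
  if x \in B then 0 else Num.max 0 (L - h x).

Definition shortfall (A : {fset V}) (h : V -> R) : R :=
  \sum_(x <- A) deficit h x ^+ 2.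

Lemma deficit_ge0 h x : 0 <= deficit h x.
Proof. by rewrite /deficit; case: ifP => // _; rewrite le_max lexx. Qed.

Lemma cvg_shortfall (A : {fset V}) (f : nat -> V -> R) h :
  (forall v, f n v @[n --> U] --> h v) ->
  shortfall A (f n) @[n --> U] --> shortfall A h.
Proof.
move=> fh; apply: cvg_big => [|x _]; first exact: add_continuous.
suff dc : deficit (f n) x @[n --> U] --> deficit h x.
  by rewrite expr2; under eq_cvg do rewrite expr2; exact: cvgM.
rewrite /deficit; case: ifP => _; first exact: cvg_cst.
rewrite maxr_absE; under eq_cvg do rewrite maxr_absE.
have Lf : L - f n x @[n --> U] --> L - h x by apply: cvgB => //; exact: cvg_cst.
apply: cvgMl; apply: cvgD; first by apply: cvgD => //; exact: cvg_cst.
by apply: cvg_norm; apply: cvgB => //; exact: cvg_cst.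
Qed.

Lemma shortfall_minimizer (A : {fset V}) : (exists h, potential N o h) ->
  exists2 h, potential N o h &
    forall g, potential N o g -> shortfall A h <= shortfall A g.
Proof.
move=> [h0 h0P]; pose S := [set shortfall A h | h in potential N o].
have lbS : lbound S 0.
  by move=> _ [h _ <-]; apply: sumr_ge0 => x _; exact: sqr_ge0.
have infS : has_inf S by split; [exists (shortfall A h0), h0|exists 0].
have /choice[f fP] n : exists h, potential N o h /\ shortfall A h < inf S + n.+1%:R^-1.
  have n0 : 0 < n.+1%:R^-1 :> R by rewrite invr_gt0.
  by have [_ [h hP <-] hn] := inf_adherent n0 infS; exists h.
have [h hP fh] := potential_ultralimit (fun n => (fP n).1).
exists h => // g gP; apply: (@le_trans _ _ (inf S)); last first.
  by apply: ge_inf; [exists 0|exists g].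
have harm : inf S + n.+1%:R^-1 @[n --> U] --> inf S.
  rewrite -[X in _ --> X]addr0; apply: cvgD; first exact: cvg_cst.
  by move=> W W0; apply: Uoo; exact: (cvg_harmonic W0).
apply: (ler_cvg_to (cvg_shortfall fh) harm).
by apply: nearW => n; exact/ltW/(fP n).2.
Qed.

(** First variation: up to the factor -2 the sum is the derivative of the shortfall at [h] in the
    direction of [g], and potentials form a convex set. *)
Lemma shortfall_variation (A : {fset V}) h g : potential N o h -> potential N o g ->
  (forall g, potential N o g -> shortfall A h <= shortfall A g) ->
  \sum_(x <- A) deficit h x * (g x - h x) <= 0.
Proof.
move=> hP gP hmin; set D := \sum_(x <- A) _.
pose Q := \sum_(x <- A) (g x - h x) ^+ 2.
have Q0 : 0 <= Q by apply: sumr_ge0 => x _; exact: sqr_ge0.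
have var s : 0 <= s <= 1 -> 2 * s * D <= s ^+ 2 * Q.
  move=> s01; have := hmin _ (potential_convex s01 hP gP).
  suff : shortfall A (fun v => h v + s * (g v - h v)) <=
      shortfall A h - 2 * s * D + s ^+ 2 * Q by lra.
  rewrite /shortfall /D /Q !mulr_sumr -sumrB -big_split; apply: ler_sum => x _ /=.
  rewrite /deficit; case: ifP => _.
    by rewrite mul0r mulr0 expr0n /= subr0 add0r mulr_ge0 ?sqr_ge0.
  (* Pointwise, the square of [(a - s b)^+] is at most the square of [a^+], minus [2 s a^+ b], plus
     [s^2 b^2]. *)
  set a := L - h x; set b := g x - h x.
  have -> : L - (h x + s * b) = a - s * b by rewrite /a; ring.
  case: (lerP 0 a) => ?; case: (lerP 0 (a - s * b)) => ?; nra.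
rewrite leNgt; apply/negP => D0.
have den : 0 < D + Q + 1 by lra.
(* This step size is at most 1 and satisfies [s * Q < D], against [2 * D <= s * Q]. *)
have s0 : 0 < D / (D + Q + 1) by rewrite divr_gt0.
have := var (D / (D + Q + 1)).
set s := D / _ in s0 *.
have s1 : s <= 1 by rewrite /s ler_pdivrMr//; lra.
rewrite (ltW s0) s1 => /(_ isT).
have sE : s * (D + Q + 1) = D by rewrite /s divfK// gt_eqF.
by nra.
Qed.

(** The source is the normalized deficit of a minimizer. By the first variation no potential has a
    larger average than the minimizer, whose average is less than [L]. *)
Lemma separating_source : 0 < L -> o \in B -> (exists h, potential N o h) ->
  (forall h, potential N o h -> exists2 v, v \notin B & h v < L) ->
  exists m nu, [/\ source N o m nu, forall x, x \in B -> nu x = 0 &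
    forall h, potential N o h -> \sum_(x <- gball N o m) h x * nu x < L].
Proof.
move=> L0 oB Pn0 short.
have /choice[f fP] j : exists h, potential N o h /\ forall g, potential N o g ->
    shortfall (gball N o j) h <= shortfall (gball N o j) g.
  by have [h ? ?] := shortfall_minimizer (gball N o j) Pn0; exists h.
(* Were all minimal shortfalls 0, the minimizers would be at least [L] off [B] on growing balls, and
   their ultralimit would contradict [short]. *)
have [j jpos] : exists j, 0 < shortfall (gball N o j) (f j).
  apply: contrapT => none.
  have f0 j x : x \in gball N o j -> x \notin B -> L <= f j x.
    move=> xj xB.
    have : shortfall (gball N o j) (f j) <= 0.
      by rewrite leNgt; apply/negP => ?; apply: none; exists j.
    rewrite /shortfall (big_fsetD1 x)//= /deficit (negbTE xB).
    have : 0 <= shortfall (gball N o j `\ x)%fset (f j).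
      by apply: sumr_ge0 => y _; exact: sqr_ge0.
    rewrite /shortfall /deficit => ? ?.
    have : Num.max 0 (L - f j x) ^+ 2 <= 0 by lra.
    by case: (lerP 0 (L - f j x)) => ? ?; nra.
  have [h hP fh] := potential_ultralimit (fun j => (fP j).1).
  have [v vB] := short h hP; rewrite ltNge => /negP; apply.
  apply: (ler_cvg_to (cvg_cst L) (fh v)).
  have [k vk] := ball_exhausts N o v.
  apply: Uoo; exists k => // n /= kn; apply: f0 => //; exact: mem_ball vk.
have [hP hmin] := fP j; set h := f j in jpos hP hmin.
set A := gball N o j in jpos hmin *.
pose S := \sum_(x <- A) deficit h x.
(* Off [B] the deficit times [L - h] is the squared deficit, and the squares have a positive sum. *)
have hS : \sum_(x <- A) deficit h x * h x < L * S.
  rewrite -subr_gt0 /S mulr_sumr -sumrB.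
  apply: lt_le_trans jpos _; apply: ler_sum => x _.
  rewrite /deficit; case: ifP => _; first by rewrite expr0n /=; lra.
  by case: (lerP 0 (L - h x)) => ?; nra.
have S0 : 0 < S.
  rewrite -(pmulr_rgt0 _ L0); apply: le_lt_trans hS; apply: sumr_ge0 => x _.
  by rewrite mulr_ge0 ?deficit_ge0//; have [] := hP.
exists j, (fun x => if x \in A then deficit h x / S else 0); split.
- split=> [x|||x xA].
  + by case: ifP => // _; rewrite divr_ge0 ?deficit_ge0// ltW.
  + by rewrite /deficit oB mul0r if_same.
  + rewrite (eq_big_seq (fun x => deficit h x / S)) => [|x ->//].
    by rewrite -mulr_suml divff// gt_eqF.
  + by rewrite (negbTE xA).
- by move=> x xB; rewrite /deficit xB mul0r if_same.
move=> g gP; rewrite (eq_big_seq (fun x => (deficit h x * g x) / S)); last first.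
  by move=> x xA; rewrite -/A xA; ring.
rewrite -mulr_suml ltr_pdivrMr//; apply: le_lt_trans hS.
rewrite -subr_le0 -sumrB; have := shortfall_variation hP gP hmin.
by under eq_bigr do rewrite mulrBr.
Qed.

End Minimax.

(** * Existence of potentials, and of potentials high off a ball *)

Section Existence.
Local Open Scope classical_set_scope.
Local Open Scope ring_scope.
Context (R : realType) (V : choiceType) (N : network R V) (o : V).
Context (U : set_system nat) {UU : UltraFilter U} (Uoo : \oo `<=` U).

(** At each vertex the sources vanish eventually, so only the unit mass at [o] survives in the
    limit. *)
Lemma escaping_green (nu g : nat -> V -> R) :
  (forall k x, 0 <= nu k x) -> (forall k x, x \in gball N o k -> nu k x = 0) ->
  (forall k x, 0 <= g k x) -> (forall k, g k o = 0) ->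
  (forall k x, laplacian N (g k) x = (x == o)%:R - nu k x) ->
  exists2 h, potential N o h & forall v, g k v @[k --> U] --> h v.
Proof.
move=> nu0 esc g0 go gl.
have [||h [gh h0 ho hl]] :=
    @ultralimit_laplacian _ _ N o U UU g (fun x => (x == o)%:R) g0 go.
- by move=> x; case: eqP => _; rewrite ?lexx ?ler01.
- move=> x; have [k xk] := ball_exhausts N o x.
  apply: Uoo; exists k => // n /= kn.
  by rewrite gl esc ?subr0//; exact: mem_ball xk.
by exists h => //; exact: potentialP.
Qed.

(** Green potentials of point masses outside growing balls converge to a potential; such points
    exist since the balls are finite. *)
Lemma potential_exists : exists h, potential N o h.
Proof.
have /choice[z zP] k : exists z, z \notin gball N o k.
  apply: contrapT => none; apply: (vertices_infinite N).
  apply: (sub_finite_set _ (finite_fset (gball N o k))) => z _ /=.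
  by apply: contrapT => /negP zk; apply: none; exists z.
have /choice[m mP] k := ball_exhausts N o (z k).
pose nu k x : R := (x == z k)%:R.
have nuP k : source N o (m k) (nu k).
  split=> [x|||x xm]; rewrite /nu.
  - by rewrite ler0n.
  - by case: eqP => // oz; have := zP k; rewrite -oz ball_o.
  - rewrite (big_fsetD1 (z k))//= eqxx big_seq big1 ?addr0// => x.
    by rewrite in_fsetD1 => /andP[/negbTE ->].
  - by case: eqP => // xz; rewrite xz mP in xm.
have /choice[g gP] k : exists g, [/\ forall v, 0 <= g v, g o = 0 &
    forall x, laplacian N g x = (x == o)%:R - nu k x].
  by have [_ [g [_ _ ? ? ?]]] := green_exists Uoo (nuP k); exists g.
have [h hP _] : exists2 h, potential N o h & forall v, g k v @[k --> U] --> h v.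
  apply: (@escaping_green nu) => [k x|k x xk|k|k|k]; try by have [] := gP k.
  by rewrite /nu; case: eqP => // xz; have := zP k; rewrite -xz xk.
by exists h.
Qed.

Lemma harnack_seq (s : seq V) : exists M, exists2 t, 0 <= t & forall f : V -> R,
  (forall x, 0 <= f x) -> f o = 0 ->
  (forall x, x \in gball N o M -> laplacian N f x <= 1) ->
  forall v, v \in s -> f v <= t.
Proof.
elim: s => [|v s [M [t t0 IH]]].
  by exists 0%N, 0 => // f _ _ _ v; rewrite in_nil.
have [M' [C C0 CP]] := harnack N o v.
exists (maxn M M'), (Num.max t C) => [|f f0 fo fl w].
  by rewrite le_max t0.
rewrite inE le_max => /orP[/eqP ->|ws]; apply/orP; [right|left].
  by apply: CP => // x xM; apply: fl; apply: mem_ball xM; exact: leq_maxr.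
by apply: IH => // x xM; apply: fl; apply: mem_ball xM; exact: leq_maxl.
Qed.

(** Cauchy-Schwarz in the form of the nonnegative energy of [f + c g]. *)
Lemma energy_cauchy (A : {fset V}) f g (c : R) :
  0 <= energy N A f f + 2 * c * energy N A f g + c ^+ 2 * energy N A g g.
Proof.
have := energy_ge0 N A (f \+ (c \*o g)).
by rewrite energyDl !energyDr !energyZl !energyZr (energyC _ _ g f); lra.
Qed.

Lemma energy_supported (A : {fset V}) n phi f : (gball N o n.+1 `<=` A)%fset ->
  (forall x, x \notin gball N o n -> phi x = 0) ->
  energy N A phi f = - 2 * \sum_(x <- gball N o n) phi x * laplacian N f x.
Proof.
move=> sub supp; rewrite energy_parts; congr (_ * _).
have subn : (gball N o n `<=` A)%fset by apply: fsubset_trans sub; exact: subset_ball.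
rewrite -(big_fset_incl _ subn) => [|x _ /supp ->]; last by rewrite mul0r.
apply: eq_big_seq => x xn; rewrite (laplacianE (A := A))//.
exact: fsubset_trans (nbrs_ball xn) sub.
Qed.

(** On the support of [phi] and its neighbours nothing is truncated, and [nu] vanishes on that
    support, so the Laplacian seen by [phi] is the unit mass at [o]. *)
Lemma energy_test_trunc n m (nu g phi : V -> R) t :
  phi o = 1 -> (forall x, x \notin gball N o n -> phi x = 0) ->
  neumann N o m nu g -> (n < m)%N -> (forall x, x \in gball N o n -> nu x = 0) ->
  (forall v, v \in gball N o n.+1 -> g v <= t) ->
  energy N (gball N o m) phi (trunc t g) = - 2.
Proof.
move=> phio supp [_ _ gl] nm nu0 gt.
rewrite (energy_supported _ (subset_ball N o nm) supp).
rewrite (big_fsetD1 o) ?ball_o//= phio mul1r.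
have gE x : x \in gball N o n.+1 -> trunc t g x = g x.
  by move=> xn; rewrite /trunc min_l// gt.
have lE x : x \in gball N o n -> laplacian N (trunc t g) x = (x == o)%:R.
  move=> xn; rewrite -[RHS]subr0 -(nu0 x xn) -gl; last exact: mem_ball (ltnW nm) xn.
  rewrite -laplacianE; last first.
    exact: fsubset_trans (nbrs_ball xn) (subset_ball N o nm).
  rewrite !(laplacianE (A := nbrs N x)) ?fsubset_refl//.
  apply: eq_big_seq => y yx; rewrite !gE//; first exact: mem_ball (leqnSn n) xn.
  by have /fsubsetP := nbrs_ball xn; apply.
rewrite lE ?ball_o// eqxx big_seq big1 ?addr0 ?mulr1// => x.
by rewrite in_fsetD1 => /andP[xo xn]; rewrite lE// (negbTE xo) mulr0.
Qed.

Lemma neumann_le_lap m nu g n : neumann N o m nu g -> (forall x, 0 <= nu x) ->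
  (n < m)%N -> forall x, x \in gball N o n -> laplacian N g x <= 1.
Proof.
move=> [_ _ gl] nu0 nm x xn; rewrite (laplacianE (A := gball N o m)).
  rewrite gl; last exact: mem_ball (ltnW nm) xn.
  by have := nu0 x; case: eqP => _ /=; lra.
exact: fsubset_trans (nbrs_ball xn) (subset_ball N o nm).
Qed.

Lemma high_potential (L : R) : recurrent N -> 0 < L ->
  exists k h, potential N o h /\ forall v, v \notin gball N o k -> L <= h v.
Proof.
move=> hrec L0; apply: contrapT => none.
have short k h : potential N o h -> exists2 v, v \notin gball N o k & h v < L.
  move=> hP; apply: contrapT => nov; apply: none; exists k, h; split=> // v vk.
  by rewrite leNgt; apply/negP => hv; apply: nov; exists v.
(* The tuple [p] holds the radius and density of a source, its Neumann solutions on balls, and their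
   limit. *)
pose good k (p : nat * (V -> R) * (nat -> V -> R) * (V -> R)) :=
  [/\ source N o p.1.1.1 p.1.1.2, forall x, x \in gball N o k -> p.1.1.2 x = 0,
    forall h, potential N o h -> \sum_(x <- gball N o p.1.1.1) h x * p.1.1.2 x < L &
  [/\ forall n, (p.1.1.1 <= n)%N -> neumann N o n p.1.1.2 (p.1.2 n),
    forall v, p.1.2 n v @[n --> U] --> p.2 v, forall v, 0 <= p.2 v, p.2 o = 0 &
    forall x, laplacian N p.2 x = (x == o)%:R - p.1.1.2 x]].
have /choice[q qP] k : exists p, good k p.
  have [m [nu [nuP nu0 nuL]]] :=
    separating_source Uoo L0 (ball_o N o k) potential_exists (short k).
  have [gn [g gP]] := green_exists Uoo nuP.
  by exists (m, nu, gn, g).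
pose mm k := (q k).1.1.1; pose nu k := (q k).1.1.2.
pose gn k := (q k).1.2; pose g k := (q k).2.
have nuP k : source N o (mm k) (nu k) by have [] := qP k.
have nu_ge0 k x : 0 <= nu k x by have [] := nuP k.
have nu_esc k x : x \in gball N o k -> nu k x = 0 by have [_ + _ _] := qP k; apply.
have gnP k n : (mm k <= n)%N -> neumann N o n (nu k) (gn k n).
  by have [_ _ _ [+ _ _ _ _]] := qP k; apply.
have gng k v : gn k n v @[n --> U] --> g k v.
  by have [_ _ _ [_ + _ _ _]] := qP k; apply.
have [h hP gh] : exists2 h, potential N o h & forall v, g k v @[k --> U] --> h v.
  by apply: (@escaping_green nu) => // k; have [_ _ _ []] := qP k.
have hL a : \sum_(x <- gball N o (mm a)) h x * nu a x < L.
  by have [_ _ + _] := qP a; apply.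
have cvg_pair (f : nat -> V -> R) (f' : V -> R) a : (forall v, f n v @[n --> U] --> f' v) ->
    \sum_(x <- gball N o (mm a)) f n x * nu a x @[n --> U] -->
    \sum_(x <- gball N o (mm a)) f' x * nu a x.
  move=> ff; apply: cvg_big => [|x _]; first exact: add_continuous.
  by apply: cvgMl.
pose pair m b a := \sum_(x <- gball N o (mm a)) gn b m x * nu a x <= L.
(* Indices are prepended: [g b] tends to [h], whose average under each source already in [s] is
   below [L], so a late [b] suits all of them. Then [g b] is approximated by its Neumann solution on
   a large ball. *)
have sel n (n0 : nat) : exists s : seq nat, [/\ size s = n0,
    forall k, k \in s -> (n <= k)%N & \forall m \near U, pairwise (pair m) s].
  elim: n0 => [|n0 [s [sz sn sp]]]; first by exists [::]; split=> //; exact: nearW.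
  have [b [nb bs]] : exists b, (n <= b)%N /\ forall a, a \in s ->
      \sum_(x <- gball N o (mm a)) g b x * nu a x < L.
    apply: (@filter_ex _ U); apply: filterI; first by apply: Uoo; exists n.
    apply: near_seq => a _; exact: cvgr_lt (cvg_pair _ _ a gh) _ (hL a).
  exists (b :: s); split=> [|k|]; first by rewrite /= sz.
    by rewrite inE => /orP[/eqP ->//|/sn].
  have : \forall m \near U, forall a, a \in s -> pair m b a.
    by apply: near_seq => a ax; apply: cvgr_le (cvg_pair _ _ a (gng b)) _ (bs a ax).
  move=> bp; apply: filterS2 sp bp => m pm ba /=.
  by apply/andP; split; [apply/allP|].
(* Order of choices: [phi] with energy at most [(1 + L)^-1], then the height [t] bounding Neumann
   solutions around its support, then the number [n0 >= t] of sources, so that the diagonal terms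
   stay of order [n0 ^ 2]. *)
have e0 : 0 < (2 * (1 + L))^-1 by rewrite invr_gt0; lra.
have [n [phi [phio supp phiE]]] := recurrent_test_function o hrec e0.
have [M [t t0 tP]] := harnack_seq (gball N o n.+1).
pose n0 := (Num.bound t).+1.
have n0t : t <= n0%:R.
  by rewrite /n0 -natr1; have := archi_boundP t0; lra.
have [s [sz sn sp]] := sel n n0.
(* The requirements on the ball are finitely many and each holds eventually, so one radius [m] meets
   them all. *)
have [m [[pm mm_m] [Mm nm]]] : exists m, (pairwise (pair m) s /\
    forall k, k \in s -> (mm k <= m)%N) /\ ((M < m)%N /\ (n < m)%N).
  apply: (@filter_ex _ U); apply: filterI; apply: filterI => //.
  - by apply: near_seq => k _; apply: Uoo; exists (mm k).
  - by apply: Uoo; exists M.+1.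
  - by apply: Uoo; exists n.+1.
pose A := gball N o m; pose u k := trunc t (gn k m).
have uu k : k \in s -> energy N A (u k) (u k) <= 2 * t.
  move=> ks; apply: energy_trunc (gnP k m (mm_m k ks)) _ _ t0 => //.
  by have [] := source_le (nuP k) (mm_m k ks).
have ub : pairwise (fun a b => energy N A (u a) (u b) <= 2 * L) s.
  apply: (sub_in_pairwise (P := mem s)) pm => [b a bs as_ /= ba|]; last exact/allP.
  apply: le_trans (energy_trunc2 (gnP a m (mm_m a as_)) (gnP b m (mm_m b bs)) _ _ t0) _ => //.
  by rewrite ler_pM2l// (source_sum _ (nuP a) (mm_m a as_)).
have FF := energy_sum_pairwise (ltW L0) uu ub.
set F := (fun x => _) in FF.
have pF : energy N A phi F = - 2 * n0%:R.
  rewrite /F -sz; elim: s {sz sp pm ub FF F} sn mm_m uu => [|k s IH] sn mm_m uu.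
    rewrite mulr0 energy_parts big1 ?mulr0// => x _.
    by rewrite /lap big1 ?mulr0// => y _; rewrite !big_nil subrr mulr0.
  have -> : (fun x => \sum_(i <- k :: s) u i x) = u k \+ (fun x => \sum_(i <- s) u i x).
    by apply/funext => x; rewrite big_cons.
  rewrite energyDr IH => [|j js|j js|j js]; last 3 first.
  - by apply: sn; rewrite inE js orbT.
  - by apply: mm_m; rewrite inE js orbT.
  - by apply: uu; rewrite inE js orbT.
  have kP := gnP k m (mm_m k (mem_head _ _)).
  rewrite (energy_test_trunc phio supp kP nm) /=; first by rewrite -natr1; ring.
    by move=> x xn; apply: nu_esc; apply: mem_ball xn; apply: sn; exact: mem_head.
  have [g0 go _] := kP; apply: tP => //; exact: neumann_le_lap kP _ Mm.
have n0_gt0 : 0 < n0%:R :> R by rewrite ltr0n.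
(* With [a = (1 + L)^-1], this coefficient makes the three terms at most [a], equal to [- 4 * a],
   and at most [2 * a]: their sum is negative. *)
have := energy_cauchy A phi F ((1 + L)^-1 / n0%:R).
(* As [phi] is supported in [gball N o n], its self-energy is the same on [A] and on
   [gball N o n.+1]. *)
rewrite pF (energy_supported _ (subset_ball N o nm) supp).
rewrite -(energy_supported _ (fsubset_refl _) supp).
rewrite sz in FF; set E := energy N _ phi phi in phiE *; set a := (1 + L)^-1.
set EF := energy N A F F in FF *; set c := a / n0%:R.
have aL : a * (1 + L) = 1 by rewrite /a mulVf// gt_eqF//; lra.
have a0 : 0 < a by rewrite /a invr_gt0; lra.
have cn : c * n0%:R = a by rewrite /c divfK// gt_eqF.
have c0 : 0 < c by rewrite /c divr_gt0.
have c2 : c ^+ 2 * EF <= 2 * a.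
  apply: (@le_trans _ _ (c ^+ 2 * (2 * (n0%:R * n0%:R + n0%:R ^+ 2 * L)))).
    rewrite ler_pM2l ?exprn_gt0//; apply: le_trans FF _.
    by rewrite ler_pM2l// lerD2r ler_pM2l.
  have -> : c ^+ 2 * (2 * (n0%:R * n0%:R + n0%:R ^+ 2 * L)) =
      2 * (c * n0%:R) * ((c * n0%:R) * (1 + L)) by ring.
  by rewrite cn aL mulr1.
have -> : 2 * c * (- 2 * n0%:R) = - 4 * (c * n0%:R) by ring.
have Ea : E <= a by apply: le_trans phiE _; rewrite invfM -/a; lra.
by rewrite cn; lra.
Qed.

End Existence.

(** * Dyadic mixtures and a potential tending to infinity *)

(** [dyadic_mix h n k] is [sum_(j < n) 2^-(j+1) h (k + j) + 2^-n h (k + n)]. *)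
Fixpoint dyadic_mix (R : realType) (V : Type) (h : nat -> V -> R) (n k : nat) (v : V) : R :=
  if n is m.+1 then h k v + 2^-1 * (dyadic_mix h m k.+1 v - h k v) else h k v.

(** Once [n] exceeds [j], the weight of [h (k + j)] no longer depends on [n]; the other terms are
    nonnegative. *)
Lemma dyadic_mix_ge (R : realType) (V : Type) (h : nat -> V -> R) n k j v :
  (forall i w, 0 <= h i w) -> (j < n)%N ->
  2^-1 ^+ j.+1 * h (k + j)%N v <= dyadic_mix h n k v.
Proof.
move=> h0; have mix0 m i : 0 <= dyadic_mix h m i v.
  by elim: m i => [|m IH] i //=; have := IH i.+1; have := h0 i v; lra.
elim: j n k => [|j IH] [|n] k //= jn.
  by rewrite addn0 expr1; have := mix0 n k.+1; lra.
have := IH n k.+1 jn; rewrite addSnnS => ih; rewrite exprS -mulrA.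
by have := h0 k v; lra.
Qed.

Theorem theorem4p1 (R : realType) (V : choiceType) (N : network R V) (o : V)
  (hrec : recurrent N) :
  exists h : V -> R, potential N o h /\ tends_to_infinity h.
Proof.
have [U [UU Uoo]] := @ultraFilterLemma _ \oo%classic _.
(* The factor [2 ^+ j.+1] in the height makes up for the weight of [h j] in the mixture. *)
have /choice[h hP] j : exists h, potential N o h /\
    exists k, forall v, v \notin gball N o k -> 2 ^+ j.+1 * j.+1%:R <= h v.
  have Lj : 0 < 2 ^+ j.+1 * j.+1%:R :> R by rewrite mulr_gt0 ?exprn_gt0 ?ltr0n.
  have [k [h [hpot hk]]] := high_potential o Uoo hrec Lj.
  by exists h; split=> //; exists k.
have h0 j v : 0 <= h j v by have [[]] := hP j.
have mixP n k : potential N o (dyadic_mix h n k).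
  elim: n k => [|n IH] k; first by have [] := hP k.
  apply: potential_convex; [|exact: (hP k).1|exact: IH].
  by apply/andP; split; lra.
(* An ultralimit of finite mixtures stands in for the infinite convex combination and inherits the
   lower bound from each term. *)
have [g gP mg] := potential_ultralimit (fun n => mixP n 0%N).
exists g; split=> // M M0.
(* For this index the single weighted term is at least [Num.bound M + 1], hence exceeds [M], off the
   ball of radius [k]. *)
have [_ [k hk]] := hP (Num.bound M).
apply: (sub_finite_set _ (finite_fset (gball N o k))) => v /= gM.
apply: contrapT => /negP vk; move: gM; apply/negP; rewrite -ltNge.
have Mb := archi_boundP (ltW M0); set j := Num.bound M in hk Mb.
apply: (lt_le_trans (y := j.+1%:R)); first by rewrite -natr1; lra.
have gj : 2^-1 ^+ j.+1 * h j v <= g v.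
  apply: (ler_cvg_to (cvg_cst _) (mg v)); apply: Uoo; exists j.+1 => // n /= jn.
  exact: (dyadic_mix_ge 0 v h0 jn).
apply: le_trans gj; rewrite exprVn ler_pdivlMl ?exprn_gt0//; exact: hk.
Qed.
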